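(* Let $G$ be a finite simple graph which is bipartite, or complete multipartite, or a blowup of a cycle. Then $\nu(G)=\eta(G)$.
   Context: A digraph $D=(V,E)$ has a finite vertex set and arc set $E\subseteq V\times V$ with no loops. For an $n$-vertex digraph $D$, a permutation of $D$ is a bijection $\sigma:V\to[n]$; an arc $u\to v$ is a descent of $\sigma$ if $\sigma(u)>\sigma(v)$, and $\mathrm{des}_D(\sigma)$ is the number of descents. The Eulerian polynomial of $D$ is $A_D(t)=\sum_{\sigma}t^{\mathrm{des}_D(\sigma)}$, summed over all bijections $\sigma:V\to[n]$. For a graph $G$, $\nu(G):=|A_D(-1)|$ where $D$ is any orientation of $G$ (this value does not depend on the orientation chosen). An ordering $\pi=(\pi_1,\dots,\pi_n)$ of $V(G)$ is an even sequence if for every $1\le i\le n$ the induced subgraph $G[\{\pi_1,\dots,\pi_i\}]$ has an even number of edges; $\eta(G)$ is the number of even sequences of $G$. A graph is complete multipartite if its vertex set can be partitioned into sets $V_1,\dots,V_r$ with $u,v$ adjacent iff they lie in different parts. A graph is a blowup of a cycle if its vertex set can be partitioned into sets $V_1,\dots,V_r$ such that $u,v$ are adjacent iff $u\in V_i$ and $v\in V_{i+1}$ for some $i$ (indices modulo $r$). *)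

(* Defs.v *)
From HB Require Import structures.
From mathcomp Require Import all_boot all_order all_algebra.

Set Implicit Arguments.
Unset Strict Implicit.
Unset Printing Implicit Defensive.

Import GRing.Theory.

Record digraph (V : finType) := Digraph {
  arc : rel V;
  arc_irrefl : irreflexive arc }.

Record sgraph (V : finType) := SGraph {
  adj : rel V;
  adj_sym : symmetric adj;
  adj_irrefl : irreflexive adj }.

Section Eulerian.
Variable V : finType.

(* A bijection V -> [n], n = #|V|, is an s : {ffun V -> 'I_#|V|} with
   [injectiveb s]; labels are 0, ..., n-1 instead of 1, ..., n. *)
Lemma labelingP (s : {ffun V -> 'I_#|V|}) :
  reflect (bijective s) (injectiveb s).
Proof.
apply: (iffP idP) => [/injectiveP s_inj|/bij_inj/injectiveP //].
by apply: inj_card_bij => //; rewrite card_ord.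
Qed.

Definition des (D : digraph V) (s : {ffun V -> 'I_#|V|}) : nat :=
  #|[set a : V * V | arc D a.1 a.2 && (s a.2 < s a.1)]|.

Definition eulerian_poly (D : digraph V) : {poly int} :=
  (\sum_(s : {ffun V -> 'I_#|V|} | injectiveb s) 'X^(des D s))%R.

Definition is_orientation (G : sgraph V) (D : digraph V) : Prop :=
  (forall u v, adj G u v = arc D u v || arc D v u) /\
  (forall u v, ~~ (arc D u v && arc D v u)).

Definition std_arc (G : sgraph V) : rel V :=
  fun u v => adj G u v && (enum_rank u < enum_rank v).

Lemma std_arc_irrefl G : irreflexive (std_arc G).
Proof. by move=> u; rewrite /std_arc ltnn andbF. Qed.

Definition std_orientation (G : sgraph V) : digraph V :=
  Digraph (std_arc_irrefl G).

Lemma std_orientationP G : is_orientation G (std_orientation G).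
Proof.
split=> u v /=; rewrite /std_arc (adj_sym G v u).
  rewrite -andb_orr -neq_ltn; case: (eqVneq u v) => [->|neq_uv].
    by rewrite adj_irrefl.
  by rewrite (inj_eq val_inj) (inj_eq enum_rank_inj) neq_uv andbT.
by case: ltngtP; rewrite !(andbF, andFb).
Qed.

(* Computed on one particular orientation; [nuE] below shows that every
   orientation gives the same value. *)
Definition nu (G : sgraph V) : nat :=
  `|((eulerian_poly (std_orientation G)).[-1])%R|%N.

Definition desI (D D' : digraph V) (b : bool) (s : {ffun V -> 'I_#|V|}) : nat :=
  #|[set a : V * V | [&& arc D a.1 a.2, arc D' a.1 a.2 == b & s a.2 < s a.1]]|.

Lemma des_split D D' s : des D s = desI D D' true s + desI D D' false s.
Proof.
rewrite /des -(cardsID [set a : V * V | arc D' a.1 a.2]) /desI.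
by congr (_ + _); apply: eq_card => a; rewrite !inE; do 2!case: (arc _ _ _); case: (s _ < s _).
Qed.

Lemma desI_sym D D' s : desI D D' true s = desI D' D true s.
Proof. by apply: eq_card => a; rewrite !inE; do 2!case: (arc _ _ _). Qed.

Lemma desI_flip (G : sgraph V) D D' (s : {ffun V -> 'I_#|V|}) : is_orientation G D ->
    is_orientation G D' -> injective s ->
  desI D D' false s + desI D' D false s =
    #|[set a : V * V | arc D a.1 a.2 && ~~ arc D' a.1 a.2]|.
Proof.
move=> [oD aD] [oD' aD'] s_inj.
rewrite -[RHS](cardsID [set a : V * V | s a.2 < s a.1]); congr (_ + _).
  by apply: eq_card => a; rewrite !inE; do 2!case: (arc _ _ _); case: (s _ < s _).
pose sw (a : V * V) := (a.2, a.1).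
have sw_inj : injective sw by move=> [? ?] [? ?] [-> ->].
rewrite /desI -[LHS](card_imset _ sw_inj); apply: eq_card => -[u v].
apply/imsetP/idP => [[[x y]]|].
  rewrite !inE /= => /and3P[D'xy /eqP Dxy lt_s] [-> ->].
  have:= aD' x y; rewrite D'xy /= => ->.
  have := oD x y; rewrite oD' D'xy Dxy /= => <-.
  by rewrite -leqNgt ltnW.
rewrite !inE /= => /and3P[nlt Duv nD'uv]; exists (v, u) => //.
have:= aD u v; rewrite Duv /= => nDvu.
have := oD' u v; rewrite oD Duv (negPf nD'uv) /= => D'vu.
rewrite !inE /= -D'vu (negPf nDvu) /= ltn_neqAle leqNgt nlt andbT.
rewrite (inj_eq val_inj) (inj_eq s_inj).
by apply: contraTneq Duv => ->; rewrite arc_irrefl.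
Qed.

Lemma nuE (G : sgraph V) (D : digraph V) : is_orientation G D ->
  `|((eulerian_poly D).[-1])%R|%N = nu G.
Proof.
move=> oD; have oS := std_orientationP G; rewrite /nu.
set S := std_orientation G in oS *.
pose k := #|[set a : V * V | arc D a.1 a.2 && ~~ arc S a.1 a.2]|.
suff -> : ((eulerian_poly D).[-1] = (-1) ^+ k * (eulerian_poly S).[-1])%R.
  by rewrite abszMsign.
rewrite !horner_sum mulr_sumr; apply: eq_bigr => s /injectiveP s_inj.
rewrite !hornerXn -exprD -[LHS]signr_odd -[RHS]signr_odd.
rewrite (des_split D S) (des_split S D) (desI_sym S D) /k -(desI_flip oD oS s_inj).
by rewrite !oddD; do 3!case: (odd _).
Qed.

End Eulerian.

Section EvenSequences.
Variables (V : finType) (G : sgraph V).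

Definition edges : {set {set V}} :=
  [set [set p.1; p.2] | p in [set p : V * V | adj G p.1 p.2]].

Definition num_induced_edges (S : {set V}) : nat :=
  #|[set e in edges | e \subset S]|.

Definition even_sequence (p : #|V|.-tuple V) : bool :=
  uniq p &&
  [forall i : 'I_#|V|, ~~ odd (num_induced_edges [set x in take i.+1 p])].

Definition eta : nat := #|[set p : #|V|.-tuple V | even_sequence p]|.

Definition bipartite : Prop :=
  exists A : {set V}, forall u v, adj G u v -> (u \in A) != (v \in A).

(* In the next two definitions a partition V_0, ..., V_(r-1) of V is given by
   the map c sending a vertex to the index of its part. *)
Definition complete_multipartite : Prop :=
  exists (r : nat) (c : V -> 'I_r), forall u v, adj G u v = (c u != c v).

(* [ordS] is the successor modulo r.  For r <= 2, or when some part is empty,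
   such a graph is bipartite. *)
Definition cycle_blowup : Prop :=
  exists (r : nat) (c : V -> 'I_r),
    forall u v, adj G u v = (c v == ordS (c u)) || (c u == ordS (c v)).

End EvenSequences.

(* Main.v *)
From mathcomp Require Import all_boot all_order all_algebra.
Require Import Defs.

Set Implicit Arguments.
Unset Strict Implicit.
Unset Printing Implicit Defensive.

Import GRing.Theory Num.Theory.

(** Let [f S] be the sum of [(-1) ^ des] over the orderings of [S] and [e S] the
    number of edges induced on [S].  Removing the vertex [v] with the least label
    gives [f S = \sum_(v in S) (-1) ^ indeg v * f (S :\ v)], and reversing all
    orderings shows [f S = 0] when [e S] is odd.  Hence only even sequences
    survive, and [f] agrees with their number up to sign as soon as some
    orientation gives all of them the same sign.  In an even sequence [v] always
    has even degree in [S].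
    - Bipartite: orient all edges from one side to the other; every even degree is
      then an even in-degree.
    - Complete multipartite: orient by part index; along an even sequence at most
      one part is odd, and it can only be the part of [v], so in-degrees are even.
    - Blowup of a cycle of length at least 3: orient cyclically; the sign is
      [(-1) ^ (k / 2)], [k] being the number of consecutive pairs of odd parts,
      since toggling a part whose two neighbours have equal parity [b] changes [k]
      by [2 * b]. *)

(** * Induced edges, degrees and descents of sequences *)

Section Orderings.
Variables (V : finType) (G : sgraph V) (D : digraph V).
Hypothesis oD : is_orientation G D.

Definition indeg (S : {set V}) (v : V) : nat := #|[set y in S | arc D y v]|.
Definition outdeg (S : {set V}) (v : V) : nat := #|[set y in S | arc D v y]|.

Lemma num_induced_edges0 : num_induced_edges G set0 = 0.
Proof.
apply: eq_card0 => e; rewrite !inE subset0.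
apply/negP => /andP[/imsetP[[a b] _ ->]] /eqP/setP/(_ a).
by rewrite !inE eqxx.
Qed.

(** The new edges join [v] to its neighbours in [S], and the orientation sorts these into in- and
    out-neighbours. *)
Lemma num_induced_edgesU1 (S : {set V}) v : v \notin S ->
  num_induced_edges G (v |: S) = num_induced_edges G S + (indeg S v + outdeg S v).
Proof.
case: oD => oDadj aD vS.
have degE : indeg S v + outdeg S v = #|[set y in S | adj G v y]|.
  rewrite -[RHS](cardsID [set y | arc D y v]); congr (_ + _); apply: eq_card => y;
    rewrite !inE oDadj; have := aD v y;
    by case: (y \in S); case: (arc D y v); case: (arc D v y).
rewrite degE /num_induced_edges -(cardsID [set e : {set V} | e \subset S]); congr (_ + _).
  apply: eq_card => e; rewrite !inE -andbA; congr (_ && _).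
  apply/andP/idP => [[]//|eS]; split=> //.
  exact: subset_trans eS (subsetUr _ _).
have inj : {in [set y in S | adj G v y] &, injective (fun y => [set v; y])}.
  move=> y z; rewrite !inE => /andP[yS _] /andP[zS _] /setP/(_ y).
  rewrite !inE eqxx orbT => /esym/orP[/eqP yv|/eqP//].
  by rewrite yv (negPf vS) in yS.
rewrite -(card_in_imset inj); apply: eq_card => e; rewrite !inE.
apply/idP/imsetP => [/and3P[neS /imsetP[[a b]]]|[y]].
  rewrite inE /= => ab eE; rewrite {e}eE in neS * => /subsetP sub.
  have := sub a; have := sub b; rewrite !inE !eqxx orbT /= => /(_ isT) hb /(_ isT) ha.
  have [av|av] := eqVneq a v.
    exists b; last by rewrite av.
    rewrite inE -av ab andbT; case/orP: hb => // /eqP bv.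
    by rewrite av bv adj_irrefl in ab.
  have aS : a \in S by case/orP: ha => // /eqP; move/eqP: av.
  have [bv|bv] := eqVneq b v.
    by exists a; [rewrite inE aS -bv adj_sym | rewrite bv setUC].
  have bS : b \in S by case/orP: hb => // /eqP; move/eqP: bv.
  by case/negP: neS; apply/subsetP => z; rewrite !inE => /orP[] /eqP->.
rewrite inE => /andP[yS vy ->]; apply/and3P; split.
- by apply/subsetPn; exists v; rewrite ?inE ?eqxx.
- by apply/imsetP; exists (v, y); rewrite ?inE.
- by apply/subsetP => z; rewrite !inE => /orP[] /eqP->; rewrite ?eqxx ?yS ?orbT.
Qed.

(** A sequence lists vertices by increasing label, so every arc from the tail into the head is a
    descent. *)
Fixpoint seq_des (q : seq V) : nat :=
  if q is x :: q' then count (fun y => arc D y x) q' + seq_des q' else 0.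

(** Suffixes replace prefixes to fit recursion on the head; reversal leads back to
    [even_sequence]. *)
Fixpoint suffix_even (q : seq V) : bool :=
  if q is x :: q'
  then ~~ odd (num_induced_edges G [set y in q]) && suffix_even q' else true.

Lemma count_card (P : pred V) q : uniq q -> count P q = #|[set y in [set x in q] | P y]|.
Proof.
move=> uq; rewrite -size_filter -(card_uniqP (filter_uniq P uq)).
by apply: eq_card => y; rewrite !inE mem_filter andbC.
Qed.

Lemma set_nil_seq : [set x in [::]] = set0 :> {set V}.
Proof. by apply/setP => y; rewrite !inE. Qed.

Lemma set_cons_seq x (q : seq V) : [set y in x :: q] = x |: [set y in q].
Proof. by apply/setP => y; rewrite !inE. Qed.

Lemma seq_des_rcons q x : seq_des (rcons q x) = seq_des q + count (arc D x) q.
Proof.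
elim: q => //= y q ->; rewrite -cats1 count_cat /= addn0.
exact: addnACA.
Qed.

(** Each edge is a descent in exactly one of the two reading directions. *)
Lemma seq_des_rev q : uniq q ->
  seq_des q + seq_des (rev q) = num_induced_edges G [set x in q].
Proof.
elim: q => [_|x q IH] /=.
  by rewrite set_nil_seq num_induced_edges0.
move=> /andP[xq uq]; rewrite set_cons_seq num_induced_edgesU1 ?inE // -IH //.
rewrite rev_cons seq_des_rcons count_rev !count_card //.
by rewrite [X in X + _ = _]addnC addnACA.
Qed.

(** * Signed and even counts of the orderings of a set *)

Definition orders (n : nat) (S : {set V}) : pred (n.-tuple V) :=
  fun q => uniq q && ([set x in q] == S).

Local Open Scope ring_scope.

(** This is [f S]. The sum is empty unless [n = #|S|]; the free [n] carries the induction. *)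
Definition signed_count n S : int := \sum_(q : n.-tuple V | orders S q) (-1) ^+ seq_des q.
Definition even_count n S : nat := #|[set q : n.-tuple V | orders S q && suffix_even q]|.

Lemma orders_cons n S (v : V) (q : n.-tuple V) :
  orders S [tuple of v :: q] = (v \in S) && orders (S :\ v) q.
Proof.
rewrite /orders /=; apply/andP/and3P => [[/andP[vq uq] /eqP<-]|[vS uq /eqP Sq]].
  split=> //; first by rewrite !inE eqxx.
  by apply/eqP/setP=> y; rewrite !inE; case: eqVneq => //= ->; apply/negbTE.
have vq : v \notin val q by have/setP/(_ v) := Sq; rewrite !inE eqxx /= => ->.
by rewrite vq uq; split=> //; rewrite set_cons_seq Sq setD1K.
Qed.

Lemma big_orders_cons n S (F : seq V -> int) :
  \sum_(q : n.+1.-tuple V | orders S q) F q =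
  \sum_(v in S) \sum_(q : n.-tuple V | orders (S :\ v) q) F (v :: q).
Proof.
rewrite pair_big_dep /=.
rewrite (reindex (fun p : V * n.-tuple V => [tuple of p.1 :: p.2])) /=.
  by apply: eq_bigl => -[v q]; rewrite orders_cons.
exists (fun q => (thead q, [tuple of behead q])) => [[v q] _|q _] /=.
  by congr (_, _); apply: val_inj.
by rewrite [RHS]tuple_eta; apply: val_inj.
Qed.

Lemma even_countE n S :
  (even_count n S)%:R = \sum_(q : n.-tuple V | orders S q) (suffix_even q)%:R :> int.
Proof.
rewrite /even_count -sum1_card natr_sum [RHS]big_mkcond [LHS]big_mkcond.
by apply: eq_bigr => q _; rewrite inE; case: (orders _ _); case: (suffix_even _).
Qed.

Lemma signed_count_odd n S : odd (num_induced_edges G S) -> signed_count n S = 0.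
Proof.
move=> oS; have revK : involutive (fun q : n.-tuple V => [tuple of rev q]).
  by move=> q; apply: val_inj; rewrite /= revK.
suff: signed_count n S = - signed_count n S.
  by move/eqP; rewrite -addr_eq0 -mulr2n mulrn_eq0 /= => /eqP.
rewrite {1}/signed_count (reindex_inj (inv_inj revK)) /signed_count -sumrN.
apply: eq_big => [q|q].
  by rewrite /orders rev_uniq; congr (_ && (_ == _)); apply/setP=> y; rewrite !inE mem_rev.
rewrite /orders rev_uniq => /andP[uq /eqP qS].
have {}qS : [set x in q] = S by rewrite -qS; apply/setP=> y; rewrite !inE mem_rev.
rewrite -qS -(seq_des_rev uq) oddD in oS.
rewrite -signr_odd -[in RHS]signr_odd; case: (odd _) oS; case: (odd _) => //= _.
Qed.

(** * Agreement of the two counts up to sign *)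

Section Invariant.
Variables (Q : {set V} -> Prop) (eps : {set V} -> bool).
Hypothesis Q0 : Q set0.
Hypothesis eps0 : eps set0 = false.
Hypothesis step : forall (S : {set V}) v, v \notin S -> odd (indeg S v) = odd (outdeg S v) ->
  Q S -> Q (v |: S) /\ eps (v |: S) = eps S (+) odd (indeg S v).

(** The degree of [v] into [S] is a difference of two even edge counts. *)
Lemma even_deg (S : {set V}) v : v \notin S -> ~~ odd (num_induced_edges G S) ->
  ~~ odd (num_induced_edges G (v |: S)) -> odd (indeg S v) = odd (outdeg S v).
Proof.
move=> vS; rewrite num_induced_edgesU1 // !oddD.
by do 3!case: (odd _).
Qed.

Lemma suffix_evenP (q : seq V) : suffix_even q -> ~~ odd (num_induced_edges G [set x in q]).
Proof.
case: q => [_|x q /andP[] //].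
by rewrite set_nil_seq num_induced_edges0.
Qed.

Lemma suffix_even_invariant (q : seq V) : uniq q -> suffix_even q -> Q [set x in q].
Proof.
elim: q => [_ _|x q IH /andP[xq uq]].
  by rewrite set_nil_seq.
rewrite /= set_cons_seq => /andP[eq1 eq2].
have xS : x \notin [set y in q] by rewrite inE.
have [//|//] := step xS _ (IH uq eq2).
exact: even_deg xS (suffix_evenP eq2) eq1.
Qed.

Lemma signed_count_even_count n S :
  signed_count n S = (-1) ^+ eps S * (even_count n S)%:R.
Proof.
elim: n S => [|n IH] S.
  rewrite even_countE /signed_count mulr_sumr; apply: eq_bigr => q /andP[_ /eqP<-].
  by rewrite tuple0 (set_nil_seq : [set x in [tuple]] = _) eps0 mul1r.
have [oS|eS] := boolP (odd (num_induced_edges G S)).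
  rewrite signed_count_odd // even_countE big1 ?mulr0 // => q /andP[_ /eqP qS].
  by rewrite -qS in oS; rewrite (contraTF (@suffix_evenP _)) // negbK.
rewrite even_countE (big_orders_cons _ S (fun q => (suffix_even q)%:R)).
rewrite /signed_count (big_orders_cons _ S (fun q => (-1) ^+ seq_des q)) mulr_sumr.
apply: eq_bigr => v vS.
have vS' : v \notin S :\ v by rewrite !inE eqxx.
transitivity ((-1) ^+ indeg (S :\ v) v * signed_count n (S :\ v)).
  rewrite mulr_sumr; apply: eq_bigr => q /andP[uq /eqP qS].
  by rewrite /= exprD count_card // qS.
transitivity ((-1) ^+ eps S * (even_count n (S :\ v))%:R : int); last first.
  rewrite even_countE; congr (_ * _); apply: eq_bigr => q /andP[_ /eqP qS].
  by rewrite /= set_cons_seq qS setD1K // eS.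
(* [Q] is known only along even sequences: either [S :\ v] has none and the term vanishes, or any
   one of them supplies [Q (S :\ v)]. *)
rewrite IH; have [->|] := posnP (even_count n (S :\ v)); first by rewrite !mulr0.
case/card_gt0P => q; rewrite inE => /andP[/andP[uq /eqP qS] eq].
have eS' := suffix_evenP eq; have QS' := suffix_even_invariant uq eq.
rewrite qS in eS' QS'.
have [|_] := step vS' _ QS'; first by apply: even_deg; rewrite ?setD1K.
rewrite setD1K // => ->; rewrite mulrA -signr_odd -signr_addb.
by rewrite addbC.
Qed.

End Invariant.

(** * Labelings as duplicate-free tuples *)

Lemma seq_desE q : uniq q -> seq_des q =
  #|[set a : V * V | [&& arc D a.1 a.2, a.1 \in q, a.2 \in q & index a.2 q < index a.1 q]]|%N.
Proof.
elim: q => [_|x q IH /= /andP[xq uq]].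
  by apply/esym/eq_card0 => a; rewrite !inE andbF.
(* Descents onto the head [x] give the [count] term; none starts at [x], whose index is 0. *)
rewrite -[RHS](cardsID [set a : V * V | a.2 == x]); congr (_ + _)%N.
  have inj : injective (fun y : V => (y, x)) by move=> y z [].
  rewrite count_card // -(card_imset _ inj); apply: eq_card => -[a b].
  rewrite !inE /=; apply/imsetP/idP => [[y]|].
    rewrite !inE => /andP[yq yx [-> ->]]; rewrite eqxx yx yq orbT /=.
    by have [xy|//] := eqVneq x y; rewrite xy yq in xq.
  case/andP=> /and4P[ab aq _ lt] /eqP bx; rewrite bx in ab lt *; exists a => //.
  rewrite !inE ab andbT; case/orP: aq => // /eqP ax.
  by rewrite ax ltnn in lt.
rewrite IH //; apply: eq_card => -[a b]; rewrite !inE /=.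
rewrite ![x == _]eq_sym.
have [->|bx] := eqVneq b x; first by rewrite (negPf xq) !andbF.
have [->|ax] := eqVneq a x; first by rewrite (negPf xq) !andbF.
by rewrite /= ltnS.
Qed.

(** The defaults [enum_rank v] and [enum_val i] only make the maps total; [label] and [unlabel] are
    mutually inverse between duplicate-free tuples and injective labelings. *)
Definition label (q : #|V|.-tuple V) : {ffun V -> 'I_#|V|} :=
  [ffun v => insubd (enum_rank v) (index v q)].
Definition unlabel (s : {ffun V -> 'I_#|V|}) : #|V|.-tuple V :=
  [tuple odflt (enum_val i) [pick v | s v == i] | i < #|V|].

Lemma uniq_mem (q : #|V|.-tuple V) : uniq q -> forall v, v \in q.
Proof.
move=> uq v; have/subset_cardP: #|q| = #|V| by rewrite (card_uniqP uq) size_tuple.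
by move/(_ (subset_predT _))/(_ v).
Qed.

Lemma labelE (q : #|V|.-tuple V) v : uniq q -> label q v = index v q :> nat.
Proof.
move=> uq; rewrite ffunE val_insubd.
by rewrite -[X in (_ < X)%N](size_tuple q) index_mem uniq_mem.
Qed.

Lemma label_inj (q : #|V|.-tuple V) : uniq q -> injective (label q).
Proof.
move=> uq u v /(congr1 val) /=; rewrite !labelE // => /(congr1 (nth u q)).
by rewrite !nth_index ?uniq_mem.
Qed.

Lemma unlabel_tnth (s : {ffun V -> 'I_#|V|}) v : injective s -> tnth (unlabel s) (s v) = v.
Proof.
move=> s_inj; rewrite tnth_mktuple; case: pickP => [w /eqP/s_inj //|/(_ v)].
by rewrite eqxx.
Qed.

Lemma unlabel_uniq (s : {ffun V -> 'I_#|V|}) : injective s -> uniq (unlabel s).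
Proof.
move=> s_inj; apply/tuple_uniqP => i j.
have [g _ gK] : bijective s by apply/labelingP/injectiveP.
by rewrite -(gK i) -(gK j) !unlabel_tnth // => ->.
Qed.

Lemma unlabelK (s : {ffun V -> 'I_#|V|}) : injective s -> label (unlabel s) = s.
Proof.
move=> s_inj; apply/ffunP => v; apply: val_inj; rewrite /= labelE ?unlabel_uniq //.
rewrite -{1}(unlabel_tnth v s_inj) (tnth_nth v) index_uniq ?unlabel_uniq //.
by rewrite size_tuple.
Qed.

Lemma labelK (q : #|V|.-tuple V) : uniq q -> unlabel (label q) = q.
Proof.
move=> uq; apply: eq_from_tnth => i.
have -> : i = label q (tnth q i).
  apply: val_inj; rewrite /= labelE // (tnth_nth (tnth q i)) index_uniq //.
  by rewrite size_tuple.
rewrite unlabel_tnth; last exact: label_inj.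
congr (tnth q _); apply: val_inj; rewrite /= labelE // (tnth_nth (tnth q i)) index_uniq //.
by rewrite size_tuple.
Qed.

Lemma eulerian_signed_count : (eulerian_poly D).[-1] = signed_count #|V| setT.
Proof.
rewrite /eulerian_poly horner_sum (reindex_onto label unlabel); last first.
  by move=> s /injectiveP; apply: unlabelK.
apply: eq_big => [q|q].
  rewrite /orders; apply/andP/andP => [[/injectiveP li /eqP<-]|[uq _]].
    have uq := unlabel_uniq li; split=> //.
    by apply/eqP/setP=> v; rewrite !inE uniq_mem.
  by rewrite labelK // eqxx; split=> //; apply/injectiveP/label_inj.
case/andP=> /injectiveP li /eqP lq; have uq : uniq q by rewrite -lq unlabel_uniq.
rewrite hornerXn seq_desE //; congr (_ ^+ _); apply: eq_card => a.
by rewrite !inE !uniq_mem //= !labelE.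
Qed.

(** As a set, each suffix of [q] is the prefix of [rev q] of the same length. *)
Lemma suffix_even_rev (q : seq V) : suffix_even q =
  [forall i : 'I_(size q), ~~ odd (num_induced_edges G [set x in take i.+1 (rev q)])].
Proof.
elim: q => [|x q IH]; first by apply/esym/forallP => -[].
rewrite /= IH; apply/andP/forallP => [[ex /forallP eq] [i /= lti]|H].
  move: lti; rewrite ltnS leq_eqVlt => /orP[/eqP->|lti].
    rewrite take_oversize ?size_rev //.
    by rewrite (_ : [set _ in _] = [set y in x :: q]) //; apply/setP=> y; rewrite !inE mem_rev.
  have := eq (Ordinal lti); rewrite /= rev_cons -cats1 takel_cat //.
  by rewrite size_rev.
split.
  have := H ord_max; rewrite take_oversize ?size_rev //.
  by rewrite (_ : [set _ in _] = [set y in x :: q]) //; apply/setP=> y; rewrite !inE mem_rev.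
apply/forallP => -[i /= lti]; have := H (Ordinal (ltnW lti : i < (size q).+1)%N).
by rewrite /= rev_cons -cats1 takel_cat // size_rev.
Qed.

Lemma eta_even_count : eta G = even_count #|V| setT.
Proof.
have revK : involutive (fun q : #|V|.-tuple V => [tuple of rev q]).
  by move=> q; apply: val_inj; rewrite /= revK.
rewrite /eta -(card_imset _ (inv_inj revK)); apply: eq_card => q.
rewrite -{1}[q]revK mem_imset; last exact: inv_inj.
rewrite !inE /even_sequence /orders /= rev_uniq suffix_even_rev size_tuple -andbA.
have [uq|//] := boolP (uniq q).
suff -> : [set x in q] = setT by rewrite eqxx.
by apply/setP=> v; rewrite !inE uniq_mem.
Qed.

(* The pair (Q, eps) certifies that every even sequence contributes with the
   same sign: Q holds along even sequences and eps records the sign. *)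
Lemma nu_eta_of_invariant (Q : {set V} -> Prop) (eps : {set V} -> bool) :
  Q set0 -> eps set0 = false ->
  (forall (S : {set V}) v, v \notin S -> odd (indeg S v) = odd (outdeg S v) ->
     Q S -> Q (v |: S) /\ eps (v |: S) = eps S (+) odd (indeg S v)) ->
  nu G = eta G.
Proof.
move=> Q0 eps0 step.
rewrite -(nuE oD) eulerian_signed_count (signed_count_even_count Q0 eps0 step).
by rewrite abszMsign eta_even_count natz absz_nat.
Qed.

End Orderings.

(** * The three graph classes *)

Section Classes.
Variables (V : finType) (G : sgraph V).

Lemma nu_eta_bipartite : bipartite G -> nu G = eta G.
Proof.
case=> A hA.
pose a : rel V := fun u v => adj G u v && (u \in A).
have a0 : irreflexive a by move=> u; rewrite /a adj_irrefl.
have oD : is_orientation G (Digraph a0).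
  split=> u v; rewrite /= /a (adj_sym G v u); have := hA u v;
  by case: (adj G u v) => // /(_ isT); case: (u \in A); case: (v \in A).
apply: (nu_eta_of_invariant oD (Q := fun=> True) (eps := fun=> false)) => // S v _ io _.
(* No arc enters a vertex of [A]; none leaves any other vertex, whose in-degree is then even by
   [io]. *)
split=> //; apply/esym/negbTE; have [vA|vA] := boolP (v \in A).
  rewrite (_ : indeg _ S v = 0) //; apply: eq_card0 => y; rewrite !inE /= /a.
  by have := hA y v; rewrite vA; case: (adj G y v); case: (y \in A); rewrite ?andbF // => /(_ isT).
rewrite io (_ : outdeg _ S v = 0) //; apply: eq_card0 => y.
by rewrite !inE /= /a (negPf vA) !andbF.
Qed.

Variables (r : nat) (c : V -> 'I_r).

Definition part_size (S : {set V}) (i : 'I_r) : nat := #|[set y in S | c y == i]|.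

Lemma part_sizeU1 (S : {set V}) v i : v \notin S ->
  part_size (v |: S) i = (c v == i) + part_size S i.
Proof.
move=> vS; rewrite /part_size.
have [<-|cv] := eqVneq (c v) i.
  rewrite (_ : [set y in v |: S | _] = v |: [set y in S | c y == c v]).
    by rewrite cardsU1 !inE (negPf vS).
  by apply/setP=> y; rewrite !inE; case: eqVneq => //= ->; rewrite eqxx.
by apply: eq_card => y; rewrite !inE; case: eqVneq => //= ->; rewrite (negPf cv) andbF.
Qed.

Lemma part_size0 i : part_size set0 i = 0.
Proof. by apply: eq_card0 => y; rewrite !inE. Qed.

Lemma card_parts (S : {set V}) (P : pred 'I_r) :
  #|[set y in S | P (c y)]| = \sum_(i | P i) part_size S i.
Proof.
rewrite -sum1_card (partition_big c P) /= => [|y]; last by rewrite inE => /andP[].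
apply: eq_bigr => i Pi; rewrite /part_size -sum1_card; apply: eq_bigl => y.
by rewrite !inE; case: eqVneq => [->|]; rewrite ?Pi ?andbT ?andbF.
Qed.

Lemma nu_eta_complete_multipartite :
  (forall u v, adj G u v = (c u != c v)) -> nu G = eta G.
Proof.
move=> hc; pose a : rel V := fun u v => c u < c v.
have a0 : irreflexive a by move=> u; rewrite /a ltnn.
have oD : is_orientation G (Digraph a0).
  split=> u v; rewrite /= /a; first by rewrite hc -neq_ltn.
  by case: ltngtP.
pose Q (S : {set V}) := forall i j, odd (part_size S i) -> odd (part_size S j) -> i = j.
apply: (nu_eta_of_invariant oD (Q := Q) (eps := fun=> false)) => //.
  by move=> i j; rewrite part_size0.
move=> S v vS io QS.
have indegE : indeg (Digraph a0) S v = \sum_(i : 'I_r | i < c v) part_size S i.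
  exact: (card_parts S (fun i : 'I_r => i < c v)).
have outdegE : outdeg (Digraph a0) S v = \sum_(i : 'I_r | c v < i) part_size S i.
  exact: (card_parts S (fun i : 'I_r => c v < i)).
have even_sum (P : pred 'I_r) : (forall i, P i -> ~~ odd (part_size S i)) ->
    odd (\sum_(i | P i) part_size S i) = false.
  move=> eP; elim/big_rec: _ => // i n Pi; rewrite oddD => ->.
  by rewrite (negPf (eP i Pi)).
(* An odd part other than that of [v] would be the only odd one, hence counted in exactly one of in-
   and out-degree, making the degree of [v] odd. *)
have even_other i : i != c v -> ~~ odd (part_size S i).
  move=> ic; apply/negP => oi.
  have even_ne j : j != i -> ~~ odd (part_size S j).
    by apply: contraNN => oj; apply/eqP/QS.
  have: odd (indeg (Digraph a0) S v + outdeg (Digraph a0) S v).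
    have [lt|gt|eq] := ltngtP i (c v); last by rewrite (val_inj eq) eqxx in ic.
    - rewrite indegE outdegE (bigD1 i) //= !oddD oi !even_sum // => j.
        by move=> cj; apply: even_ne; apply: contraTneq cj => ->; rewrite -leqNgt ltnW.
      by case/andP=> _; apply: even_ne.
    - rewrite indegE outdegE [X in (_ + X)%N](bigD1 i) //= !oddD oi !even_sum // => j.
        by case/andP=> _; apply: even_ne.
      by move=> cj; apply: even_ne; apply: contraTneq cj => ->; rewrite -leqNgt ltnW.
  by rewrite oddD io addbb.
split.
  have even_otherU i : odd (part_size (v |: S) i) -> i = c v.
    apply: contraTeq => ic; rewrite part_sizeU1 // eq_sym (negPf ic).
    exact: even_other.
  by move=> i j /even_otherU -> /even_otherU ->.
rewrite indegE even_sum // => i lt; apply: even_other.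
by apply: contraTneq lt => ->; rewrite ltnn.
Qed.

Lemma nu_eta_long_cycle_blowup : 2 < r ->
  (forall u v, adj G u v = (c v == ordS (c u)) || (c u == ordS (c v))) ->
  nu G = eta G.
Proof.
move=> r_gt2 hc; pose a : rel V := fun u v => c v == ordS (c u).
(* This is where [2 < r] enters: two steps never close up, so no edge is oriented both ways. *)
have ordSS_neq (i : 'I_r) : ordS (ordS i) != i.
  apply/negP => /eqP/(congr1 val) /=; rewrite -[(_ %% r).+1]addn1 modnDml addn1 -addn2.
  rewrite -[RHS](modn_small (ltn_ord i)) -[X in _ = X %% r]addn0 => /eqP.
  by rewrite eqn_modDl !modn_small // (leq_trans _ r_gt2).
have ordS_neq (i : 'I_r) : ordS i != i.
  by apply: contra_neq (ordSS_neq i) => ii; rewrite !ii.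
have a0 : irreflexive a by move=> u; rewrite /a eq_sym (negPf (ordS_neq _)).
have oD : is_orientation G (Digraph a0).
  split=> u v; rewrite /= /a ?hc //.
  by apply/negP => /andP[/eqP-> /eqP/esym/eqP]; rewrite (negPf (ordSS_neq _)).
pose k (S : {set V}) := \sum_(i : 'I_r) (odd (part_size S i) && odd (part_size S (ordS i))).
apply: (nu_eta_of_invariant oD (Q := fun=> True) (eps := fun S => odd (k S)./2)) => //.
  by rewrite /k big1 // => i _; rewrite part_size0.
move=> S v vS io _; split=> //.
pose p := ord_pred (c v).
have Sp : ordS p = c v by rewrite /p ord_predK.
have indegE : indeg (Digraph a0) S v = part_size S p.
  by apply: eq_card => y; rewrite !inE /= /a -Sp (inj_eq (@ordS_inj r)) eq_sym.
have outdegE : outdeg (Digraph a0) S v = part_size S (ordS (c v)).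
  by apply: eq_card => y; rewrite !inE.
have pcv : p != c v by rewrite -Sp eq_sym ordS_neq.
(* Only the summands at [c v] and at its predecessor [p] involve the part of [v]; they coincide when
   the two neighbouring parts have equal parity. *)
have kE T : (odd (part_size T p) = odd (part_size T (ordS (c v)))) -> k T =
  (odd (part_size T (c v)) && odd (part_size T p)).*2 +
  \sum_(i : 'I_r | (i != c v) && (i != p)) (odd (part_size T i) && odd (part_size T (ordS i))).
  move=> eqT; rewrite /k (bigD1 (c v)) //= (bigD1 p) //= Sp -eqT.
  by rewrite addnA andbC -addnn.
have sU i : i != c v -> part_size (v |: S) i = part_size S i.
  by move=> ic; rewrite part_sizeU1 // eq_sym (negPf ic).
rewrite indegE outdegE in io; have Sne := ordS_neq (c v).
rewrite indegE (kE S io) (kE (v |: S)) (sU p pcv) ?(sU _ Sne) //.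
under eq_bigr => i /andP[ic ip].
  rewrite !sU //; last by rewrite -Sp (inj_eq (@ordS_inj r)).
  over.
(* The doubled term halves without carry to a single bit. Adding [v] toggles its own part, so this
   bit flips exactly when part [p] is odd. *)
rewrite part_sizeU1 // eqxx /= !halfD !odd_double /= !add0n !doubleK !oddD.
set m := (\sum_(i < r | _) _).
by case: (odd (part_size S (c v))); case: (odd (part_size S p)); case: (odd m./2).
Qed.

(** For [r <= 2] the cyclic orientation breaks down, but the graph is bipartite, with the parts of
    index 0 and 1 as sides. *)
Lemma nu_eta_cycle_blowup :
  (forall u v, adj G u v = (c v == ordS (c u)) || (c u == ordS (c v))) ->
  nu G = eta G.
Proof.
move=> hc; have [r_le2|r_gt2] := leqP r 2; last exact: nu_eta_long_cycle_blowup.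
apply: nu_eta_bipartite; exists [set v | c v == 0 :> nat] => u v uv.
(* Adjacent vertices in one part would, by [hc], make a vertex adjacent to itself. *)
have: c u != c v.
  by apply: contraTneq uv => cuv; rewrite hc -cuv cuv -hc adj_irrefl.
rewrite !inE -(inj_eq val_inj) /=.
have := leq_trans (ltn_ord (c u)) r_le2; have := leq_trans (ltn_ord (c v)) r_le2.
by case: (nat_of_ord (c u)) => [|[|?]] //; case: (nat_of_ord (c v)) => [|[|?]].
Qed.

End Classes.

Theorem theorem1p4 (V : finType) (G : sgraph V)
  (hG : bipartite G \/ complete_multipartite G \/ cycle_blowup G) :
  nu G = eta G.
Proof.
case: hG => [|[[r [c]]|[r [c]]]].
- exact: nu_eta_bipartite.
- exact: nu_eta_complete_multipartite.
- exact: nu_eta_cycle_blowup.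
Qed.
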